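(* Let $(\mathfrak{g},[\cdot,\cdot,\cdot],\alpha)$ be a $3$-Hom-Lie algebra, let $(V;\rho,\nu,A)$ be a generalized representation of it, let $\beta:\mathfrak g\to\mathfrak g$ be an algebra morphism (i.e. a linear map with $\beta[x,y,z]=[\beta(x),\beta(y),\beta(z)]$ and $\beta\circ\alpha=\alpha\circ\beta$), and let $B:V\to V$ be a linear map such that for all $x,x_1,x_2\in\mathfrak g$ $$B\circ\rho(x_1,x_2)=\rho(\beta(x_1),\beta(x_2))\circ B,\qquad B\circ\nu(x)=\nu(\beta(x))\circ(B\otimes B),\qquad B\circ A=A\circ B.$$ Put $[\cdot,\cdot,\cdot]_\beta=[\cdot,\cdot,\cdot]\circ\beta^{\otimes3}$, $\widetilde\rho(x_1,x_2)=B\circ\rho(x_1,x_2)$ and $\widetilde\nu(x)=B\circ\nu(x)$. Then $(V;\widetilde\rho,\widetilde\nu,B\circ A)$ is a generalized representation of the $3$-Hom-Lie algebra $(\mathfrak g,[\cdot,\cdot,\cdot]_\beta,\beta\circ\alpha)$.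
   Context: All vector spaces are over a field $\mathbb{K}$ of characteristic $0$; $\mathfrak{gl}(V)=\mathrm{End}(V)$. A $3$-Hom-Lie algebra is a triple $(\mathfrak{g},[\cdot,\cdot,\cdot],\alpha)$: a vector space $\mathfrak{g}$, a trilinear skew-symmetric bracket, and a linear map $\alpha:\mathfrak g\to\mathfrak g$ with $\alpha[x,y,z]=[\alpha(x),\alpha(y),\alpha(z)]$, satisfying for all $x,y,z,u,v\in\mathfrak g$ $$[\alpha(u),\alpha(v),[x,y,z]]=[[u,v,x],\alpha(y),\alpha(z)]+[\alpha(x),[u,v,y],\alpha(z)]+[\alpha(x),\alpha(y),[u,v,z]].$$ Bracket in degree one. For a vector space $W$ with a linear map $\gamma:W\to W$, and a linear map $\Pi:\wedge^3W\to W$ with $\gamma\circ\Pi=\Pi\circ\gamma^{\otimes 3}$, the bracket $[\Pi,\Pi]^{3HL}:(\wedge^2W)^{\otimes 2}\otimes W\to W$ is $$[\Pi,\Pi]^{3HL}(a\wedge b,c\wedge d,e)=-2\big(\Pi(\Pi(a,b,c),\gamma d,\gamma e)+\Pi(\gamma c,\Pi(a,b,d),\gamma e)+\Pi(\gamma c,\gamma d,\Pi(a,b,e))-\Pi(\gamma a,\gamma b,\Pi(c,d,e))\big).$$ Generalized representation. Let $\pi$ denote the bracket of $\mathfrak g$. Given $A\in\mathfrak{gl}(V)$ and linear maps $\rho:\wedge^2\mathfrak g\to\mathfrak{gl}(V)$, $\nu:\mathfrak g\to\mathrm{Hom}(\wedge^2V,V)$, regard $\pi$ as a map $\wedge^3(\mathfrak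 g\oplus V)\to\mathfrak g\oplus V$ (zero when an argument is in $V$), and put $\overline\rho(x+u,y+v,z+w)=\rho(x,y)(w)+\rho(y,z)(u)+\rho(z,x)(v)$ and $\overline\nu(x+u,y+v,z+w)=\nu(x)(v\wedge w)+\nu(y)(w\wedge u)+\nu(z)(u\wedge v)$. Then $(V;\rho,\nu,A)$ is a generalized representation of $\mathfrak g$ with respect to $A$ if $\Pi=\pi+\overline\rho+\overline\nu$ commutes with $\gamma=\alpha+A$ (where $(\alpha+A)(x+u)=\alpha(x)+A(u)$; that is, $\gamma\circ\Pi=\Pi\circ\gamma^{\otimes3}$, so that the bracket is defined) and $[\Pi,\Pi]^{3HL}=0$ on $W=\mathfrak g\oplus V$. *)

(* Defs.v *)
From mathcomp Require Import all_boot all_algebra.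

Set Implicit Arguments.
Unset Strict Implicit.
Unset Printing Implicit Defensive.

Import GRing.Theory.
Local Open Scope ring_scope.

Definition trilinear (K : fieldType) (U W : lmodType K)
    (f : U -> U -> U -> W) : Prop :=
  [/\ forall y z, linear (fun x => f x y z),
      forall x z, linear (fun y => f x y z)
    & forall x y, linear (fun z => f x y z)].

(* The two transpositions generate the symmetric group on three letters. *)
Definition skew_symmetric3 (K : fieldType) (U W : lmodType K)
    (f : U -> U -> U -> W) : Prop :=
  (forall x y z, f y x z = - f x y z) /\ (forall x y z, f x z y = - f x y z).

(* By the universal property of the exterior square, these are the linear maps
   from the exterior square of U to W. *)
Definition alternating_bilinear (K : fieldType) (U W : lmodType K)
    (f : U -> U -> W) : Prop :=
  bilinear_for *:%R *:%R f /\ (forall x, f x x = 0).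

Definition is_3HomLie (K : fieldType) (g : lmodType K)
    (br : g -> g -> g -> g) (alpha : {linear g -> g}) : Prop :=
  [/\ trilinear br,
      skew_symmetric3 br,
      forall x y z, alpha (br x y z) = br (alpha x) (alpha y) (alpha z)
    & forall x y z u v,
        br (alpha u) (alpha v) (br x y z) =
          br (br u v x) (alpha y) (alpha z)
          + br (alpha x) (br u v y) (alpha z)
          + br (alpha x) (alpha y) (br u v z)].

(* The element [Pi, Pi](a /\ b, c /\ d, e) of W; a multilinear map vanishes
   iff it vanishes on these decomposable arguments. *)
Definition bracket3HL (K : fieldType) (W : lmodType K) (gamma : W -> W)
    (Pi : W -> W -> W -> W) (a b c d e : W) : W :=
  - 2%:R *: (Pi (Pi a b c) (gamma d) (gamma e)
             + Pi (gamma c) (Pi a b d) (gamma e)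
             + Pi (gamma c) (gamma d) (Pi a b e)
             - Pi (gamma a) (gamma b) (Pi c d e)).

Section DirectSum.

Variables (K : fieldType) (g V : lmodType K).

Definition oplus_map (alpha : g -> g) (A : V -> V) (p : g * V) : g * V :=
  (alpha p.1, A p.2).

Definition pi_bar (br : g -> g -> g -> g) (p q r : g * V) : g * V :=
  (br p.1 q.1 r.1, 0).

Definition rho_bar (rho : g -> g -> V -> V) (p q r : g * V) : g * V :=
  (0, rho p.1 q.1 r.2 + rho q.1 r.1 p.2 + rho r.1 p.1 q.2).

Definition nu_bar (nu : g -> V -> V -> V) (p q r : g * V) : g * V :=
  (0, nu p.1 q.2 r.2 + nu q.1 r.2 p.2 + nu r.1 p.2 q.2).

Definition total_bracket (br : g -> g -> g -> g) (rho : g -> g -> V -> V)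
    (nu : g -> V -> V -> V) (p q r : g * V) : g * V :=
  pi_bar br p q r + rho_bar rho p q r + nu_bar nu p q r.

(* The first three clauses say that rho is a linear map from the exterior
   square of g to gl(V), and nu a linear map from g to the space of linear
   maps from the exterior square of V to V. *)
Definition is_generalized_rep (br : g -> g -> g -> g) (alpha : {linear g -> g})
    (rho : g -> g -> {linear V -> V}) (nu : g -> V -> V -> V)
    (A : {linear V -> V}) : Prop :=
  let Pi := total_bracket br (fun x y => rho x y) nu in
  let gamma := oplus_map alpha A in
  [/\ forall w, alternating_bilinear (fun x y => rho x y w),
      forall x, alternating_bilinear (nu x),
      forall u v, linear (fun x => nu x u v),
      forall p q r, gamma (Pi p q r) = Pi (gamma p) (gamma q) (gamma r)
    & forall a b c d e, bracket3HL gamma Pi a b c d e = 0].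

End DirectSum.

(* Main.v *)
Require Import Defs.
From HB Require Import structures.
From mathcomp Require Import all_boot all_algebra.

(** Both conclusions are instances of Yau's twisting principle. Let a linear
    map G be an endomorphism of a ternary bracket Pi that commutes with its
    structure map gamma, and replace Pi by G o Pi = Pi o G^3 and gamma by
    G o gamma. An identity whose terms are all built from two brackets and one
    layer of structure maps survives: the factors of G move outwards, and the
    twisted identity is the image under G o G of the original one. That the
    new structure map preserves the new bracket is where G o gamma = gamma o G
    enters.

    For the algebra itself G is beta. For the representation G is the direct
    sum of beta and B on W = g + V: the hypotheses on beta and B say that this
    map is an endomorphism of Pi = pi + rho_bar + nu_bar commuting with
    alpha + A ([total_bracket_morph]), and the bracket assembled from the
    twisted data is G o Pi ([total_bracket_twist]). Hence the degree-one
    bracket of the twisted data is the image under G o G of [Pi, Pi] = 0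
    ([bracket3HL_twist]). *)

Set Implicit Arguments.
Unset Strict Implicit.
Unset Printing Implicit Defensive.

Import GRing.Theory.
Local Open Scope ring_scope.

(** The twisted bracket is also beta o br, which makes the invariance of the
    axioms visible: each side of the twisted fundamental identity is the image
    under beta o beta of the corresponding side of the original one. *)
Lemma is_3HomLie_twist (K : fieldType) (g : lmodType K)
    (br : g -> g -> g -> g) (alpha beta : {linear g -> g}) :
    is_3HomLie br alpha ->
    (forall x y z, beta (br x y z) = br (beta x) (beta y) (beta z)) ->
    beta \o alpha =1 alpha \o beta ->
  is_3HomLie (fun x y z => br (beta x) (beta y) (beta z)) (beta \o alpha).
Proof.
move=> [[lin1 lin2 lin3] [skew12 skew23] br_alpha fundamental] br_beta comm.
have comm_pt x : beta (alpha x) = alpha (beta x) by exact: comm.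
split=> /=.
- split=> [y z|x z|x y] k u v.
  + by rewrite linearP lin1.
  + by rewrite linearP lin2.
  + by rewrite linearP lin3.
- by split=> x y z; [exact: skew12 | exact: skew23].
- by move=> x y z; rewrite br_alpha br_beta !comm_pt.
- by move=> x y z u v; rewrite -!br_beta fundamental !linearD.
Qed.

(** Every term of the degree-one bracket contains Pi twice and gamma once on
    each remaining argument, so the twist contributes the same factor G o G
    to all of them. The twisted data are given pointwise so that the lemma
    applies to brackets that agree with G o Pi only extensionally. *)
Lemma bracket3HL_twist (K : fieldType) (W : lmodType K) (G : {linear W -> W})
    (gamma gamma' : W -> W) (Pi Pi' : W -> W -> W -> W) :
    (forall p q r, G (Pi p q r) = Pi (G p) (G q) (G r)) ->
    (forall p q r, Pi' p q r = G (Pi p q r)) ->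
    gamma' =1 G \o gamma ->
  forall a b c d e,
    bracket3HL gamma' Pi' a b c d e = G (G (bracket3HL gamma Pi a b c d e)).
Proof.
move=> G_Pi Pi'E gamma'E a b c d e.
rewrite /bracket3HL !gamma'E !Pi'E /= -!G_Pi !linearZ /=.
by congr (_ *: _); rewrite !(linearB, linearD).
Qed.

Section DirectSumTwist.

Variables (K : fieldType) (g V : lmodType K).
Variables (beta : {linear g -> g}) (B : {linear V -> V}).

Fact oplus_map_linear : linear (oplus_map beta B).
Proof. by move=> k p q; rewrite /oplus_map /= !linearP. Qed.

HB.instance Definition _ :=
  GRing.isLinear.Build K (g * V)%type (g * V)%type _ (oplus_map beta B)
    oplus_map_linear.

Variables (br : g -> g -> g -> g) (rho : g -> g -> {linear V -> V}).
Variable nu : g -> V -> V -> V.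

Hypothesis br_beta :
  forall x y z, beta (br x y z) = br (beta x) (beta y) (beta z).

Let Pi := total_bracket br (fun x y => rho x y) nu.

Lemma total_bracketE p q r :
  Pi p q r =
    (br p.1 q.1 r.1,
     rho p.1 q.1 r.2 + rho q.1 r.1 p.2 + rho r.1 p.1 q.2
     + (nu p.1 q.2 r.2 + nu q.1 r.2 p.2 + nu r.1 p.2 q.2)).
Proof.
rewrite /Pi /total_bracket /pi_bar /rho_bar /nu_bar.
by congr pair; rewrite /= ?addr0 ?add0r.
Qed.

(** The equivariance of rho, nu and the bracket of g are the components of a
    single statement about the direct sum. *)
Lemma total_bracket_morph p q r :
    (forall x1 x2, B \o rho x1 x2 =1 rho (beta x1) (beta x2) \o B) ->
    (forall x u v, B (nu x u v) = nu (beta x) (B u) (B v)) ->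
  oplus_map beta B (Pi p q r) =
    Pi (oplus_map beta B p) (oplus_map beta B q) (oplus_map beta B r).
Proof.
move=> B_rho B_nu; rewrite !total_bracketE /oplus_map /= br_beta !linearD /=.
have B_rho_pt x y w : B (rho x y w) = rho (beta x) (beta y) (B w).
  exact: B_rho.
by rewrite !B_nu !B_rho_pt.
Qed.

Lemma total_bracket_twist p q r :
  total_bracket (fun x y z => br (beta x) (beta y) (beta z))
    (fun x y => B \o rho x y) (fun x u v => B (nu x u v)) p q r =
  oplus_map beta B (Pi p q r).
Proof.
rewrite total_bracketE /total_bracket /pi_bar /rho_bar /nu_bar /oplus_map /=.
by rewrite br_beta !linearD; congr pair; rewrite /= ?addr0 ?add0r.
Qed.

End DirectSumTwist.

Lemma alternating_bilinear_comp (K : fieldType) (U W X : lmodType K)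
    (f : U -> U -> W) (h : {linear W -> X}) :
  alternating_bilinear f -> alternating_bilinear (fun x y => h (f x y)).
Proof.
move=> [[f_linl f_linr] f_alt]; split; last by move=> x; rewrite f_alt linear0.
by split=> x k u v /=; rewrite ?f_linl ?f_linr linearP.
Qed.

Theorem proposition2p9 (K : fieldType) (charK : [pchar K] =i pred0)
    (g V : lmodType K)
    (br : g -> g -> g -> g) (alpha : {linear g -> g})
    (hg : is_3HomLie br alpha)
    (rho : g -> g -> {linear V -> V}) (nu : g -> V -> V -> V)
    (A : {linear V -> V})
    (hrep : is_generalized_rep br alpha rho nu A)
    (beta : {linear g -> g})
    (hbeta : forall x y z, beta (br x y z) = br (beta x) (beta y) (beta z))
    (hbeta_alpha : beta \o alpha =1 alpha \o beta)
    (B : {linear V -> V})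
    (hBrho : forall x1 x2,
       B \o rho x1 x2 =1 rho (beta x1) (beta x2) \o B)
    (hBnu : forall x u v, B (nu x u v) = nu (beta x) (B u) (B v))
    (hBA : B \o A =1 A \o B) :
  let br_beta := fun x y z => br (beta x) (beta y) (beta z) in
  let rho_t : g -> g -> {linear V -> V} := fun x1 x2 => B \o rho x1 x2 in
  let nu_t := fun x u v => B (nu x u v) in
  is_3HomLie br_beta (beta \o alpha) /\
  is_generalized_rep br_beta (beta \o alpha) rho_t nu_t (B \o A).
Proof.
move=> br_beta rho_t nu_t; split; first exact: is_3HomLie_twist.
case: hrep => rho_alt nu_alt nu_lin gamma_Pi bracket0.
pose G : {linear (g * V)%type -> (g * V)%type} := oplus_map beta B.
have G_Pi p q r := total_bracket_morph hbeta p q r hBrho hBnu.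
have twistE p q r := total_bracket_twist B rho nu hbeta p q r.
have G_gamma p : G (oplus_map alpha A p) = oplus_map alpha A (G p).
  by congr pair; [exact: hbeta_alpha | exact: hBA].
split.
- by move=> w; apply: alternating_bilinear_comp (rho_alt w).
- by move=> x; apply: alternating_bilinear_comp (nu_alt x).
- by move=> u v k x y; rewrite /nu_t nu_lin linearP.
- move=> p q r; rewrite !twistE.
  (* The twisted structure map is convertible to G o (alpha + A). *)
  rewrite -[LHS]/(G (oplus_map alpha A (G _))) -G_gamma gamma_Pi.
  by congr (G _); exact: G_Pi.
- move=> a b c d e.
  by rewrite (bracket3HL_twist (gamma := oplus_map alpha A) G_Pi twistE)
       ?bracket0 ?linear0.
Qed.
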